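(* Let $X$ be a real Hausdorff locally convex space, let $\tau$ be a locally convex topology on $X^{\ast}$ with $\sigma(X^{\ast},X)\subset\tau\subset\beta(X^{\ast},X)$, and let $X^{\ast\ast}:=(X^{\ast},\tau)^{\ast}$. Let $f,g:X\rightarrow\mathbb{R}\cup\{+\infty\}$ be functions such that $\operatorname{dom}f\cap\operatorname{dom}g\neq\emptyset$ and each of $f$ and $g$ has a continuous affine minorant. Then the following statements are equivalent: $(i)$ $\overline{\operatorname{co}}^{w^{\ast\ast}}(f+g)=(\overline{\operatorname{co}}^{w^{\ast\ast}}f)+(\overline{\operatorname{co}}^{w^{\ast\ast}}g)$ (as functions on $X^{\ast\ast}$). $(ii)$ For all $x\in\operatorname{dom}f\cap\operatorname{dom}g$ and all $\varepsilon>\varepsilon_{f+g}(x)$, $$\partial_{\varepsilon}(f+g)(x)=\operatorname{cl}^{\tau}\Big(\bigcup_{\substack{\varepsilon_{1}+\varepsilon_{2}=\varepsilon\\ \varepsilon_{1},\varepsilon_{2}\geq 0}}\big(\partial_{\varepsilon_{1}}f(x)+\partial_{\varepsilon_{2}}g(x)\big)\Big).$$ $(iii)$ For all $x\in\operatorname{dom}f\cap\operatorname{dom}g$ and all $\varepsilon>0$, $$\partial_{\varepsilon}(f+g)(x)=\bigcap_{\alpha>\varepsilon}\operatorname{cl}^{\tau}\Big(\bigcup_{\substack{\varepsilon_{1}+\varepsilon_{2}=\alpha\\ \varepsilon_{1},\varepsilon_{2}\geq 0}}\big(\partial_{\varepsilon_{1}}f(x)+\partial_{\varepsilon_{2}}g(x)\big)\Big).$$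 $(iv)$ For all $x\in X$ and all $\varepsilon>0$, $$\partial_{\varepsilon}(f+g)(x)\subset\operatorname{cl}^{\tau}\big(\partial_{2\varepsilon}f(x)+\partial_{2\varepsilon}g(x)\big).$$
   Context: $X^{\ast}$ is the topological dual of $X$; $\sigma(X^{\ast},X)$ is the weak* topology and $\beta(X^{\ast},X)$ the strong topology on $X^{\ast}$. The bidual $X^{\ast\ast}$ is the topological dual of $(X^{\ast},\tau)$; $X$ is identified with a linear subspace of $X^{\ast\ast}$, and $X^{\ast\ast}$ carries the topology $w^{\ast\ast}:=\sigma(X^{\ast\ast},X^{\ast})$. Closure in $(X^{\ast},\tau)$ is denoted $\operatorname{cl}^{\tau}$. For $f:X\to\overline{\mathbb{R}}:=\mathbb{R}\cup\{\pm\infty\}$: $\operatorname{dom}f:=\{x\in X: f(x)<+\infty\}$, $\operatorname{epi}f:=\{(x,\lambda)\in X\times\mathbb{R}: f(x)\le\lambda\}$, and $f^{\ast}(x^{\ast}):=\sup_{x\in X}\{\langle x^{\ast},x\rangle-f(x)\}$ for $x^{\ast}\in X^{\ast}$. For $\varepsilon\in\mathbb{R}$ and $x\in X$, $\partial_{\varepsilon}f(x):=\{x^{\ast}\in X^{\ast}: f^{\ast}(x^{\ast})+f(x)\le\langle x^{\ast},x\rangle+\varepsilon\}$, with $\partial_{\varepsilon}f(x)=\emptyset$ if $f(x)\notin\mathbb{R}$ or $\varepsilon<0$. The convention $+\infty+(-\infty)=+\infty$ is used. Each function $f$ on $X$ is extended to $X^{\ast\ast}$ by the value $+\infty$ on $X^{\ast\ast}\setminus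 X$; $\overline{\operatorname{co}}^{w^{\ast\ast}}f:X^{\ast\ast}\to\overline{\mathbb{R}}$ is the $w^{\ast\ast}$-closed convex hull of this extension, i.e. the function whose epigraph is the closed convex hull of the epigraph of the extension in $(X^{\ast\ast},w^{\ast\ast})\times\mathbb{R}$. For $h:X\to\overline{\mathbb{R}}$ and $x\in\operatorname{dom}h$, $\varepsilon_{h}(x):=\inf\{\alpha>0:\partial_{\alpha}h(x)\neq\emptyset\}$ (possibly $+\infty$). A continuous affine minorant of $f$ is a function $x\mapsto\langle x^{\ast},x\rangle+c\le f(x)$ with $x^{\ast}\in X^{\ast}$, $c\in\mathbb{R}$. *)

(* Defs.v *)
From HB Require Import structures.
From mathcomp Require Import all_boot all_order all_algebra.
From mathcomp Require Import all_classical all_reals all_analysis.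

Set Implicit Arguments.
Unset Strict Implicit.
Unset Printing Implicit Defensive.

Import Order.TTheory GRing.Theory Num.Theory.
Import numFieldNormedType.Exports.

Local Open Scope classical_set_scope.
Local Open Scope ring_scope.

Section dual.
Context {R : realType} (E : tvsType R).

Definition dual_pred : {pred (E -> R^o)} :=
  [pred phi | `[< linear phi /\ continuous phi >] ].

Lemma dual_predP (phi : E -> R^o) :
  reflect (linear phi /\ continuous phi) (phi \in dual_pred).
Proof. exact: asboolP. Qed.

Lemma dual_pred_submod : submod_closed dual_pred.
Proof.
split=> [|a u v].
  apply/dual_predP; split=> [b x y|]; last exact: cst_continuous.
  by rewrite /GRing.zero/= scaler0 addr0.
move=> /dual_predP[lu cu] /dual_predP[lv cv]; apply/dual_predP; split.
  move=> b x y; rewrite !fctE lu lv !scalerDr !scalerA (mulrC b a).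
  by rewrite addrACA.
move=> x; apply: (@cvgD _ R^o).
  by apply: cvgZl_tmp; exact: cu.
exact: cv.
Qed.

HB.instance Definition _ :=
  GRing.isSubmodClosed.Build R (E -> R^o) dual_pred dual_pred_submod.

(* The topological dual of E, as a vector space. *)
Record dual := Dual { dual_fun :> E -> R^o ; _ : dual_fun \in dual_pred }.

HB.instance Definition _ := [isSub for dual_fun].
HB.instance Definition _ := [Choice of dual by <:].
HB.instance Definition _ := [SubChoice_isSubLmodule of dual by <:].

(* sigma(E^*, E): the topology of pointwise convergence on E. *)
Definition weakstar : Type :=
  initial_topology (fun phi : dual => (phi : {ptws E -> R^o})).
HB.instance Definition _ := Topological.on weakstar.
HB.instance Definition _ := GRing.Lmodule.copy weakstar dual.

Definition weakstar_open : set_system dual := @open weakstar.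

Definition tvs_bounded : set (set E) :=
  [set B | forall U : set E, nbhs 0 U ->
    exists2 r : R, 0 < r & forall s : R, r <= `|s| -> B `<=` [set s *: u | u in U]].

(* beta(E^*, E): the topology of uniform convergence on the bounded subsets. *)
Definition strong_open : set_system dual :=
  @open (initial_topology
    (fun phi : dual => (phi : {family tvs_bounded, E -> R^o}))).

End dual.

(* A topology on a bare type, given by its open sets, so that topologies on
   one type can be compared by inclusion. *)
Record topology (T : Type) := Topology {
  top_open : set_system T ;
  top_openT : top_open setT ;
  top_openI : setI_closed top_open ;
  top_open_bigcup : forall (I : Type) (A : I -> set T),
    (forall i, top_open (A i)) -> top_open (\bigcup_i A i) }.

(* The type T endowed with the topology t. *)
Definition top_type (T : Type) (t : topology T) : Type := T.

HB.instance Definition _ (T : choiceType) (t : topology T) :=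
  Choice.copy (top_type t) T.
HB.instance Definition _ (T : choiceType) (t : topology T) :=
  isOpenTopological.Build (top_type t)
    (top_openT t) (@top_openI _ t) (@top_open_bigcup _ t).
HB.instance Definition _ (R : realType) (V : lmodType R) (t : topology V) :=
  GRing.Lmodule.copy (top_type t) V.

Record lctopology (R : realType) (V : lmodType R) := LCTopology {
  lc_top :> topology V ;
  lc_add_continuous :
    continuous (fun x : top_type lc_top * top_type lc_top => x.1 + x.2) ;
  lc_scale_continuous :
    continuous (fun z : R^o * top_type lc_top => z.1 *: z.2) ;
  lc_locally_convex : exists2 B : set_system (top_type lc_top),
    (forall b, b \in B -> convex_set b) & basis B }.

(* The locally convex space (V, tau). *)
Definition lcs (R : realType) (V : lmodType R) (tau : lctopology V) : Type :=
  top_type tau.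

Section lcs.
Context (R : realType) (V : lmodType R) (tau : lctopology V).
HB.instance Definition _ := Topological.on (lcs tau).
HB.instance Definition _ := GRing.Lmodule.on (lcs tau).
HB.instance Definition _ := PreTopologicalLmod_isTvs.Build R (lcs tau)
  (@lc_add_continuous _ _ tau) (@lc_scale_continuous _ _ tau)
  (@lc_locally_convex _ _ tau).
(* The factory above only provides the uniform structure. *)
HB.instance Definition _ :=
  PreTopologicalNmodule_isTopologicalNmodule.Build (lcs tau)
    (@lc_add_continuous _ _ tau).
HB.instance Definition _ :=
  TopologicalNmodule_isTopologicalLmodule.Build R (lcs tau)
    (@lc_scale_continuous _ _ tau).
HB.instance Definition _ :=
  Uniform_isTvs.Build R (lcs tau) (@lc_locally_convex _ _ tau).
End lcs.

Section functions.
Context {R : realType}.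
Implicit Types eps : R.
Local Open Scope ereal_scope.

Definition dom (T : Type) (f : T -> \bar R) : set T := [set x | f x < +oo].

Definition epi (T : Type) (f : T -> \bar R) : set (T * R^o) :=
  [set p | f p.1 <= (p.2)%:E].

Context {X : tvsType R}.
Implicit Type f : X -> \bar R.

Definition conjugate f (xs : dual X) : \bar R :=
  ereal_sup [set (xs x)%:E - f x | x in setT].

(* The sum is the one for which (+oo) + (-oo) = +oo. *)
Definition subdiff eps f (x : X) : set (dual X) :=
  [set xs | [/\ f x \is a fin_num, (0 <= eps)%R &
    (conjugate f xs + f x)%dE <= (xs x + eps)%:E]].

Definition eps_inf f (x : X) : \bar R :=
  ereal_inf [set alpha%:E | alpha in
    [set alpha : R | (0 < alpha)%R /\ subdiff alpha f x !=set0]].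

Definition has_affine_minorant f :=
  exists (xs : dual X) (c : R), forall x, (xs x + c)%:E <= f x.

Definition minkowski_sum (A B : set (dual X)) : set (dual X) :=
  [set (a + b)%R | a in A & b in B].

Definition subdiff_sum eps f g (x : X) : set (dual X) :=
  \bigcup_(e in [set e : R * R | [/\ (e.1 + e.2)%R = eps, (0 <= e.1)%R &
                                     (0 <= e.2)%R]])
    minkowski_sum (subdiff e.1 f x) (subdiff e.2 g x).

End functions.

HB.instance Definition _ (K : numDomainType) (V W : preTopologicalLmodType K) :=
  Topological.on (V * W)%type.

Section closed_convex_hull.
Context {R : realType} {V : preTopologicalLmodType R}.

Definition closed_convex_hull (A : set V) : set V :=
  smallest [set C | closed C /\ convex_set C] A.

End closed_convex_hull.

Section clco.
Context {R : realType} {V : preTopologicalLmodType R}.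
Implicit Type F : V -> \bar R.

(* The function with epigraph closed_convex_hull (epi F), see epi_clco. *)
Definition clco F (v : V) : \bar R :=
  ereal_inf [set l%:E | l in [set l : R | closed_convex_hull (epi F) (v, l)]].

Let hull_closed F : closed (closed_convex_hull (epi F)).
Proof. by apply: closed_bigI => C [[]]. Qed.

Let shift_continuous (t : R) :
  continuous (fun p : V * R^o => (p.1, p.2 + t) : V * R^o).
Proof.
move=> p; apply: (@cvg_pair _ _ _ _ (nbhs p.1) (nbhs (p.2 + t : R^o))).
  exact: cvg_fst.
by apply: (@cvgD _ R^o); [exact: cvg_snd|exact: cvg_cst].
Qed.

Let hull_up F (v : V) (l t : R) : 0 <= t ->
  closed_convex_hull (epi F) (v, l) -> closed_convex_hull (epi F) (v, l + t).
Proof.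
move=> t0 H C [[cC vC] FC].
pose D := (fun p : V * R^o => (p.1, p.2 + t) : V * R^o) @^-1` C.
suff: D (v, l) by [].
apply: H; split; [split|].
- by apply: (closed_comp _ cC) => p _; exact: shift_continuous.
- move=> [x a] [y b] k /set_mem Da /set_mem Db; apply/mem_set; rewrite /D/=.
  have := vC _ _ k (mem_set Da) (mem_set Db) => /set_mem.
  congr (C _); congr pair => /=.
  rewrite /conv/= /GRing.scale/= !mulrDr addrACA -mulrDl.
  by rewrite unstable.add_onemK mul1r.
- move=> [x a] /= Fa; apply: FC => /=; apply: le_trans Fa _ => /=.
  by rewrite lee_fin lerDl.
Qed.

Lemma epi_clco F : epi (clco F) = closed_convex_hull (epi F).
Proof.
apply/seteqP; split=> -[v l]; last first.
  by move=> H; apply: ereal_inf_lbound; exists l.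
rewrite /epi/= => Hl; apply: (hull_closed (F := F)) => B [[B1 B2] /= [nB1 nB2] BB].
have /nbhs_ballP[e /= e0 eB] := nB2.
have : (clco F v < (l + e / 2)%:E)%E.
  by apply: le_lt_trans Hl _; rewrite lte_fin ltrDl divr_gt0.
move=> /ereal_inf_lt[_ [m /= Hm <-]]; rewrite lte_fin => ml.
have [lm|lm] := leP l m; last first.
  exists (v, l); split.
    by rewrite -(subrKC m l); apply: hull_up => //; rewrite subr_ge0 ltW.
  by apply: BB; split; exact: nbhs_singleton.
exists (v, m); split=> //; apply: BB; split; first exact: nbhs_singleton.
apply: eB; rewrite -ball_normE/= ler0_norm ?subr_le0// opprB ltrBlDl.
by apply: lt_trans ml _; rewrite ltrD2l ltr_pdivrMr// ltr_pMr// ltr1n.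
Qed.

End clco.

Section bidual.
Context {R : realType} {X : tvsType R} (tau : lctopology (dual X)).

Definition cl_tau (A : set (dual X)) : set (dual X) := @closure (lcs tau) A.

(* The bidual of X, with the topology sigma(X^**, X^* ). *)
Definition bidual : Type := weakstar (lcs tau).

(* f, extended by +oo outside the canonical image of X in the bidual; if X is
   Hausdorff then the infimum is over at most one x. *)
Definition bidual_ext (f : X -> \bar R) (z : bidual) : \bar R :=
  ereal_inf [set f x | x in
    [set x | forall xs : dual X, (z : dual (lcs tau)) xs = xs x]].

End bidual.

(* Main.v *)
From HB Require Import structures.
Require Import Defs.
From mathcomp Require Import all_boot all_order all_algebra.
From mathcomp Require Import all_classical all_reals all_analysis.
From mathcomp Require Import ring lra.
Import Order.TTheory GRing.Theory Num.Theory.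
Import numFieldNormedType.Exports.
Local Open Scope classical_set_scope.
Local Open Scope ring_scope.

(** Write h = f + g, and for z in the bidual let f**(z) be the supremum of
z(y) - f*(y) over y in the dual of X.

By Hahn-Banach separation in the bidual times the line, the closed convex hull
of f (extended by +oo to the bidual) is f** as soon as f has a nonempty domain
and a continuous affine minorant ([biconjugate_le_clco],
[clco_le_biconjugate]). Since f** + g** <= h** always holds, (i) amounts to
h** <= f** + g** ([biconjugate_subadditive]).

(i) => (ii). If h** <= f** + g**, then h* is the tau-closed hull of the infimal
convolution of f* and g*: if h*(y) <= rho and e > 0, then there are a and b with
a + b arbitrarily close to y and f*(a) + g*(b) <= rho + e
([inf_convolution_dense]); this is a separation argument in the dual times the
line. Hence the e'-subdifferential of h at x lies in the closure of the sum
set of parameter e whenever e' < e. If e exceeds the infimum of the parameters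
whose subdifferential is nonempty, then every point of the e-subdifferential is
the limit, along a segment, of points of e'-subdifferentials with e' < e.

(ii) => (iii) => (iv) follows from the monotonicity of the subdifferentials in
the parameter and from their tau-closedness.

(iv) => (i). Given y with h*(y) finite and e > 0, the definition of h* as a
supremum provides an x such that y is an e-subgradient of h at x. By (iv), y is
approached by sums a + b of 2e-subgradients of f and g at x, so that
f*(a) + g*(b) <= h*(y) + O(e); the tau-continuity of z then gives
z(y) - h*(y) <= f**(z) + g**(z).

Hahn-Banach itself is obtained by applying Zorn's lemma to sublinear
functionals: a minimal one is linear, because a sublinear functional can be
lowered along any convex set ([sublinear_lower]). *)

(** * Sublinear functionals and the Hahn-Banach theorem *)

Section hahn_banach.
Context {R : realType} {V : lmodType R}.
Implicit Types (p q : V -> R) (C : set V).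

(** Subadditive and positively homogeneous; homogeneity is only asked as an
inequality and for positive factors, see [sublinearZ] and [sublinear0]. *)
Definition sublinear p :=
  (forall x y, p (x + y) <= p x + p y) /\
  (forall t x, 0 < t -> p (t *: x) <= t * p x).

(** Convexity, with plain real coefficients. *)
Definition segment_closed C :=
  forall t a b, 0 <= t -> t <= 1 -> C a -> C b -> C (t *: a + (1 - t) *: b).

Lemma sublinearZ {p} : sublinear p -> forall t x, 0 < t -> p (t *: x) = t * p x.
Proof.
move=> [_ pZ] t x t0; apply/eqP; rewrite eq_le pZ//=.
have := pZ t^-1 (t *: x); rewrite invr_gt0 scalerA mulVf ?gt_eqF// scale1r.
by move=> /(_ t0); rewrite ler_pdivlMl.
Qed.

Lemma sublinear0 {p} : sublinear p -> p 0 = 0.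
Proof.
move=> sp; have := sublinearZ sp 2 0 (ltr0Sn _ _).
by rewrite scaler0 => h; lra.
Qed.

Lemma sublinearN {p} : sublinear p -> forall x, - p (- x) <= p x.
Proof.
move=> sp x; have [pD _] := sp.
by have := pD x (- x); rewrite subrr sublinear0// => h; lra.
Qed.

(** A sublinear functional that is at least [k] on the convex set [C] can be
lowered so that its value on the opposite of [C] is at most [- k]. The lowered
functional maps [v] to the infimum of [q (v + s *: c) - s * k] for [s >= 0] and
[c] in [C]; convexity of [C] gives its subadditivity. *)
Lemma sublinear_lower {q C} (k : R) : sublinear q -> segment_closed C ->
  C !=set0 -> (forall c, C c -> k <= q c) ->
  exists q', [/\ sublinear q', forall x, q' x <= q x &
    forall c, C c -> q' (- c) <= - k].
Proof.
move=> sq cC [c0 Cc0] kC.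
pose S v := [set r | exists s c, [/\ 0 <= s, C c & r = q (v + s *: c) - s * k]].
have S0 v : S v !=set0 by exists (q (v + 0 *: c0) - 0 * k); exists 0, c0.
have Slb v : lbound (S v) (- q (- v)).
  move=> _ [s [c [s0 Cc ->]]].
  have [qD _] := sq.
  have := qD (v + s *: c) (- v); rewrite addrAC subrr add0r.
  have : s * k <= q (s *: c).
    move: s0; rewrite le_eqVlt => /predU1P[<-|s0].
      by rewrite scale0r mul0r sublinear0.
    by rewrite sublinearZ// ler_pM2l// kC.
  by lra.
have Sge v r : S v r -> inf (S v) <= r.
  by move=> Sr; apply: ge_inf => //; exists (- q (- v)); exact: Slb.
exists (fun v => inf (S v)); split.
- split=> [x y|t x t0].
  + rewrite -lerBlDr; apply: lb_le_inf => // _ [s [c [s0 Cc ->]]].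
    rewrite lerBlDr -lerBlDl; apply: lb_le_inf => // _ [s' [c' [s'0 Cc' ->]]].
    rewrite lerBlDl.
    have [qD _] := sq.
    have := qD (x + s *: c) (y + s' *: c').
    have [ss'|ss'] := eqVneq (s + s') 0.
      have /andP[/eqP-> /eqP->] : (s == 0) && (s' == 0) by rewrite -paddr_eq0// ss'.
      rewrite !scale0r !mul0r !subr0 !addr0 => h; apply: le_trans h.
      by apply: Sge; exists 0, c; rewrite scale0r addr0 mul0r subr0.
    (* s c + s' c' = (s + s') c'' with c'' in C *)
    have ss'0 : 0 < s + s' by rewrite lt_neqAle eq_sym ss' addr_ge0.
    pose c'' := (s / (s + s')) *: c + (1 - s / (s + s')) *: c'.
    have Cc'' : C c''.
      apply: cC => //; first by apply: divr_ge0 => //; exact: ltW.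
      by rewrite ler_pdivrMr// mul1r lerDl.
    have -> : x + s *: c + (y + s' *: c') = x + y + (s + s') *: c''.
      rewrite addrACA; congr (_ + _).
      rewrite scalerDr !scalerA; congr (_ *: _ + _ *: _); field => //.
    have : S (x + y) (q (x + y + (s + s') *: c'') - (s + s') * k).
      by exists (s + s'), c''; split => //; exact: ltW.
    by move=> /Sge; lra.
  + rewrite -ler_pdivrMl//; apply: lb_le_inf => // _ [s [c [s0 Cc ->]]].
    rewrite ler_pdivrMl//; apply: Sge; exists (t * s), c; split => //.
      by rewrite mulr_ge0// ltW.
    by rewrite mulrBr -(sublinearZ sq)// scalerDr scalerA mulrA.
- by move=> x; apply: Sge; exists 0, c0; rewrite scale0r addr0 mul0r subr0.
- move=> c Cc; apply: Sge; exists 1, c.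
  by rewrite scale1r addNr mul1r sublinear0// sub0r.
Qed.

(** The pointwise infimum of a chain of sublinear functionals below [p] is
sublinear, and it is finite because [q x >= - q (- x) >= - p (- x)]. *)
Lemma minimal_sublinear {p} : sublinear p ->
  exists q, [/\ sublinear q, forall x, q x <= p x &
    forall q', sublinear q' -> (forall x, q' x <= q x) -> q' = q].
Proof.
move=> sp.
pose T := {q : V -> R | sublinear q /\ forall x, q x <= p x}.
pose leT (s t : T) := `[< forall x, sval t x <= sval s x >].
have [|r s t /asboolP rs /asboolP st|s t /asboolP st /asboolP ts|A totA|] :=
    @Zorn T leT.
- by move=> t; apply/asboolP.
- by apply/asboolP => x; exact: le_trans (st x) (rs x).
- case: s t st ts => [u su] [v sv] /= uv vu.
  apply: eq_exist; apply/funext => x; apply/eqP.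
  by rewrite eq_le uv vu.
- have [A0|/set0P[t0 At0]] := eqVneq A set0.
    have tp : sublinear p /\ forall x, p x <= p x by [].
    by exists (exist _ p tp) => s; rewrite A0.
  pose S x := [set sval t x | t in A].
  have S0 x : S x !=set0 by exists (sval t0 x); exists t0.
  have Slb x : lbound (S x) (- p (- x)).
    move=> _ [[q [sq qp]] _ <-] /=.
    by apply: le_trans (sublinearN sq x); rewrite lerN2.
  have Sge x t : A t -> inf (S x) <= sval t x.
    move=> At; apply: ge_inf; last by exists t.
    by exists (- p (- x)); exact: Slb.
  have sS : sublinear (fun x => inf (S x)).
    split=> [x y|t x t_gt0].
    + rewrite -lerBlDr; apply: lb_le_inf => // _ [s As <-].
      rewrite lerBlDr -lerBlDl; apply: lb_le_inf => // _ [s' As' <-].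
      rewrite lerBlDl.
      have [/asboolP ss'|/asboolP ss'] := totA _ _ As As'.
      * apply: le_trans (Sge _ _ As') _.
        have [[+ _] _] := svalP s' => /(_ x y) h; apply: le_trans h _.
        by rewrite lerD2r.
      * apply: le_trans (Sge _ _ As) _.
        have [[+ _] _] := svalP s => /(_ x y) h; apply: le_trans h _.
        by rewrite lerD2l.
    + rewrite -ler_pdivrMl//; apply: lb_le_inf => // _ [s As <-].
      rewrite ler_pdivrMl//; apply: le_trans (Sge _ _ As) _.
      by have [[_ +] _] := svalP s; exact.
  have tS : sublinear (fun x => inf (S x)) /\ forall x, inf (S x) <= p x.
    split=> // x; apply: le_trans (Sge x _ At0) _.
    by have [_] := svalP t0.
  exists (exist _ (fun x => inf (S x)) tS) => s As; apply/asboolP => x /=.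
  exact: Sge.
move=> [q [sq qp]] minq; exists q; split=> // q' sq' q'q.
have tq' : sublinear q' /\ forall x, q' x <= p x.
  by split=> // x; exact: le_trans (q'q x) (qp x).
have : exist _ q' tq' = exist _ q (conj sq qp) :> T.
  by apply: minq; apply/asboolP.
by move=> /(congr1 sval).
Qed.

(** A minimal sublinear functional [q] is odd, hence linear: lowering it along
[[set y]] with [k = q y] does not change it, so that [q (- y) <= - q y]. *)
Lemma hahn_banach {p} : sublinear p ->
  exists l : V -> R^o, linear l /\ forall x, l x <= p x.
Proof.
move=> /minimal_sublinear[q [sq qp minq]]; exists q; split=> //.
have qN y : q (- y) = - q y.
  apply/eqP; rewrite eq_le; apply/andP; split; last first.
    by have := sublinearN sq y; lra.
  have cy : segment_closed [set y].
    by move=> t a b _ _ -> ->; rewrite /= -scalerDl addrC subrK scale1r.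
  have [|_ -> //|q' [sq' q'q q'y]] := sublinear_lower (q y) sq cy.
    by exists y.
  by rewrite -{1}(minq q' sq' q'q); exact: q'y.
have [qD _] := sq.
have qDE x y : q (x + y) = q x + q y.
  apply/eqP; rewrite eq_le qD/=.
  by have := qD (- x) (- y); rewrite -opprD !qN; lra.
have qZE t x : q (t *: x) = t * q x.
  have [t0|t0|->] := ltgtP t 0; first 2 last.
  - by rewrite scale0r mul0r sublinear0.
  - rewrite -[t]opprK scaleNr qN sublinearZ// ?oppr_gt0//; lra.
  - by rewrite sublinearZ.
by move=> t x y; rewrite qDE qZE.
Qed.

Lemma separation_sublinear {N : V -> R} {C} : sublinear N -> segment_closed C ->
  C !=set0 -> (forall c, C c -> 1 <= N c) ->
  exists l : V -> R^o, [/\ linear l, forall x, l x <= N x &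
    forall c, C c -> 1 <= l c].
Proof.
move=> sN cC C0 NC.
have [q [sq qN qC]] := sublinear_lower 1 sN cC C0 NC.
have [l [ll lq]] := hahn_banach sq.
exists l; split=> // [x|c Cc]; first exact: le_trans (lq x) (qN x).
have l0 : l 0 = 0 by have := ll (-1) 0 0; rewrite addr0 scaler0 scaleN1r addNr.
have lN : l (- c) = - l c.
  by have := ll (-1) c 0; rewrite addr0 scaleN1r l0 addr0 scaleN1r.
by have := le_trans (lq _) (qC c Cc); rewrite lN lerN2.
Qed.

End hahn_banach.

(** * Separation in a locally convex space times the line *)

Section dual_linear.
Context {R : realType} {E : tvsType R}.

Lemma dual_is_linear (phi : dual E) : linear phi.
Proof. by case: phi => phi /= /dual_predP[]. Qed.

Lemma dual_continuous (phi : dual E) : continuous (phi : E -> R^o).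
Proof. by case: phi => phi /= /dual_predP[]. Qed.

HB.instance Definition _ (phi : dual E) :=
  GRing.isLinear.Build R E R^o _ phi (dual_is_linear phi).

Lemma dualDE (y y' : dual E) x : (y + y') x = y x + y' x.
Proof. by []. Qed.

Lemma dualZE t (y : dual E) x : (t *: y) x = t * y x.
Proof. by []. Qed.

Lemma dualNE (y : dual E) x : (- y) x = - y x.
Proof. by rewrite -scaleN1r dualZE mulN1r. Qed.

Lemma dualBE (y y' : dual E) x : (y - y') x = y x - y' x.
Proof. by rewrite dualDE dualNE. Qed.

(** The element of the dual given by a continuous linear form. *)
Definition to_dual (l : E -> R^o) (ll : linear l) (cl : continuous l) : dual E :=
  Dual (introT (dual_predP l) (conj ll cl)).

End dual_linear.

Section separation_product.
Context {R : realType} {V : lmodType R}.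

(** Separation of a point [(y, r)] from a convex set in [V * R], measured by a
nonnegative sublinear functional [N] on [V] and the distance [d] on [R]. The
separating linear form is given by its restriction [l] to [V], which is bounded
by [N], and its slope [b]. *)
Lemma separation_product (N : V -> R) (C : set (V * R^o)) (y : V) (r d : R) :
  sublinear N -> (forall v, 0 <= N v) -> 0 < d -> segment_closed C ->
  C !=set0 ->
  (forall c s, C (c, s) -> N (c - y) < 1 -> d <= `|s - r|) ->
  exists (l : V -> R^o) (b : R), [/\ linear l, forall v, l v <= N v &
    forall c s, C (c, s) -> l y + b * r + 1 <= l c + b * s].
Proof.
move=> sN N0 d0 cC [[c0 s0] C0] NC.
(* N' is at least 1 on the translate C' of C by the opposite of (y, r) *)
pose N' (v : V * R^o) : R := N v.1 + `|v.2| / d.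
have sN' : sublinear N'.
  split=> [[v a] [w b]|t [v a] t0]; rewrite /N'/=.
    rewrite addrACA lerD//; first by case: sN => + _; exact.
    by rewrite -mulrDl ler_pM2r ?invr_gt0// ler_normD.
  rewrite mulrDr (sublinearZ sN)// lerD2l.
  by rewrite /GRing.scale/= normrM gtr0_norm// mulrA.
pose C' : set (V * R^o) := [set c | C (c.1 + y, c.2 + r)].
have cC' : segment_closed C'.
  move=> t [a1 a2] [b1 b2] t0 t1; rewrite /C'/= => Ca Cb.
  have := cC t _ _ t0 t1 Ca Cb; congr (C _); congr pair => /=.
    rewrite !scalerDr addrACA -scalerDl.
    by rewrite addrC (addrC t) subrK scale1r addrC.
  rewrite !scalerDr addrACA -scalerDl.
  by rewrite addrC (addrC t) subrK scale1r addrC.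
have C'0 : C' !=set0.
  by exists (c0 - y, s0 - r); rewrite /C'/= !subrK.
have NC' c : C' c -> 1 <= N' c.
  case: c => c s; rewrite /C'/N'/= => Cc.
  have [Nc|Nc] := leP 1 (N c).
    by rewrite (le_trans Nc)// lerDl divr_ge0// ltW.
  have := NC _ _ Cc; rewrite !addrK => /(_ Nc) ds.
  have : 1 <= `|s| / d by rewrite ler_pdivlMr// mul1r.
  by have := N0 c; lra.
have [l [ll lN lC]] := separation_sublinear sN' cC' C'0 NC'.
have l00 : l (0, 0) = 0.
  by have := ll (-1) 0 0; rewrite addr0 scaler0 scaleN1r addNr.
pose b : R := l (0, 1).
have lb v (s : R) : l (v, s) = l (v, 0) + b * s.
  have -> : (v, s : R^o) = s *: (0, 1 : R^o) + (v, 0 : R^o).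
    by congr pair => /=; rewrite ?scaler0 ?add0r// addr0 /GRing.scale/= mulr1.
  by rewrite ll [RHS]addrC mulrC.
have ll0 t v w : l (t *: v + w, 0) = t * l (v, 0) + l (w, 0).
  rewrite -[RHS]ll; congr (l (_, _)).
  by rewrite /= scaler0 addr0.
exists (fun v => l (v, 0)), b; split=> //.
- by move=> v; have := lN (v, 0); rewrite /N'/= normr0 mul0r addr0.
- move=> c s Cc.
  have : C' (c - y, s - r) by rewrite /C'/= !subrK.
  move=> /lC; rewrite lb.
  have := ll0 (-1) y c; rewrite scaleN1r addrC => ->.
  by lra.
Qed.

End separation_product.

Section separation_tvs.
Context {R : realType} {E : tvsType R}.

Lemma tvs_absorbing {U : set E} : nbhs 0 U ->
  forall v, exists2 e : R, 0 < e & forall t, `|t| < e -> U (t *: v).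
Proof.
move=> U0 v.
have /= := @scale_continuous R E (0, v) U; rewrite scale0r => /(_ U0).
move=> []/= [B1 B2] [/= B10 B2v] BU.
have /nbhs_ballP[e /= e0 eB] := B10.
exists e => // t te; apply: (BU (t, v)); split; last exact: nbhs_singleton.
by apply: eB; rewrite -ball_normE/= sub0r normrN.
Qed.

(** The Minkowski gauge of a convex neighborhood of [0]. *)
Lemma gauge_exists (U : set E) : nbhs 0 U -> segment_closed U ->
  exists N : E -> R, [/\ sublinear N, forall v, 0 <= N v,
    forall v, N v < 1 -> U v & forall v, U v -> N v <= 1].
Proof.
move=> U0 cU.
have U00 : U 0 := nbhs_singleton U0.
pose S v := [set t : R | 0 < t /\ U (t^-1 *: v)].
have S0 v : S v !=set0.
  have [e e0 eU] := tvs_absorbing U0 v.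
  exists (e / 2)^-1; split; first by rewrite invr_gt0 divr_gt0.
  rewrite invrK; apply: eU; rewrite gtr0_norm ?divr_gt0//.
  by rewrite ltr_pdivrMr// ltr_pMr// ltr1n.
have Slb v : lbound (S v) 0 by move=> t [/ltW].
have Sge v t : S v t -> inf (S v) <= t by move=> ?; apply: ge_inf => //; exists 0.
have UZ t v : 0 <= t -> t <= 1 -> U v -> U (t *: v).
  by move=> t0 t1 Uv; have := cU t _ _ t0 t1 Uv U00; rewrite scaler0 addr0.
exists (fun v => inf (S v)); split.
- split=> [v w|t v t0].
  + rewrite -lerBlDr; apply: lb_le_inf => // t [t0 Ut].
    rewrite lerBlDr -lerBlDl; apply: lb_le_inf => // s [s0 Us].
    rewrite lerBlDl; apply: Sge; split; first exact: addr_gt0.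
    have st0 : 0 < t + s by exact: addr_gt0.
    have -> : (t + s)^-1 *: (v + w) =
        (t / (t + s)) *: (t^-1 *: v) + (1 - t / (t + s)) *: (s^-1 *: w).
      rewrite scalerDr !scalerA; congr (_ *: _ + _ *: _); field.
        by rewrite !gt_eqF.
      by rewrite !gt_eqF.
    apply: cU => //; first by apply: divr_ge0; exact: ltW.
    by rewrite ler_pdivrMr// mul1r lerDl ltW.
  + rewrite -ler_pdivrMl//; apply: lb_le_inf => // s [s0 Us].
    rewrite ler_pdivrMl//; apply: Sge; split; first exact: mulr_gt0.
    by rewrite scalerA invfM mulrAC mulVf ?gt_eqF// mul1r.
- by move=> v; exact: lb_le_inf.
- move=> v; rewrite ltNge => /negP Sv; apply: contrapT => Uv; apply: Sv.
  apply: lb_le_inf => // t [t0 Ut]; rewrite leNgt; apply/negP => t1.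
  apply: Uv; have := UZ t _ (ltW t0) (ltW t1) Ut.
  by rewrite scalerA divff ?gt_eqF// scale1r.
- by move=> v Uv; apply: Sge; split=> //; rewrite invr1 scale1r.
Qed.

Lemma linear_continuous_of_le1 (l : E -> R^o) (U : set E) : linear l ->
  nbhs 0 U -> (forall v, U v -> l v <= 1) -> continuous l.
Proof.
move=> ll U0 lU x.
have l0 : l 0 = 0 by have := ll (-1) 0 0; rewrite addr0 scaler0 scaleN1r addNr.
have lN v : l (- v) = - l v.
  by have := ll (-1) v 0; rewrite addr0 scaleN1r l0 addr0 scaleN1r.
have lD v w : l (v + w) = l v + l w.
  by have := ll 1 v w; rewrite !scale1r.
have lZ t v : l (t *: v) = t * l v.
  by have := ll t v 0; rewrite !addr0 l0 addr0.
pose W := U `&` (-%R @` U).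
have W0 : nbhs 0 W by apply: filterI => //; exact: nbhs0N.
have lW v : W v -> `|l v| <= 1.
  move=> [Uv [w Uw vw]]; rewrite ler_norml lU// andbT.
  by rewrite -vw lN lerN2 lU.
apply/(@cvgrPdist_le _ R^o) => e e0.
have := @nbhsT _ E _ x (nbhs0Z (lt0r_neq0 e0) W0).
apply: filterS => _ [_ [w Ww <-] <-].
rewrite lD opprD addrA subrr sub0r normrN lZ normrM gtr0_norm//.
by rewrite -[leRHS]mulr1 ler_pM2l// lW.
Qed.

Lemma nbhs0_translate {y : E} {U : set E} :
  nbhs y U -> nbhs 0 ((fun v => v + y) @^-1` U).
Proof.
move=> yU; have := @nbhsB _ E _ _ (- y) yU; rewrite addNr.
by apply: filterS => _ [u Uu <-] /=; rewrite addrAC addNr add0r.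
Qed.

Lemma separation_tvs (C : set (E * R^o)) (y : E) (r d : R) (U : set E) :
  0 < d -> segment_closed C -> C !=set0 -> nbhs y U ->
  (forall c s, C (c, s) -> U c -> d <= `|s - r|) ->
  exists (z : dual E) (b : R),
    forall c s, C (c, s) -> z y + b * r + 1 <= z c + b * s.
Proof.
move=> d0 cC C0 yU CU.
have [B cB [Bo Bb]] := @locally_convex R E.
have [W [BW W0] WU] := Bb _ _ (nbhs0_translate yU).
have W_nbhs : nbhs 0 W.
  by rewrite nbhsE; exists W => //; split=> //; exact: Bo.
have cW : segment_closed W.
  move=> t a b t0 t1 Wa Wb.
  have t01 : (0 <= t <= 1) by rewrite t0.
  have := cB W (mem_set BW) a b (Itv01 t0 t1) (mem_set Wa) (mem_set Wb).
  by move=> /set_mem.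
have [N [sN N0 NW WN]] := gauge_exists _ W_nbhs cW.
have [c s Cc Nc|l [b [ll lN lC]]] := separation_product N C y r d sN N0 d0 cC C0.
  by apply: (CU c) => //; have := WU _ (NW _ Nc); rewrite /= subrK.
have cl : continuous l.
  apply: (linear_continuous_of_le1 l W) => // v Wv.
  exact: le_trans (lN v) (WN _ Wv).
by exists (to_dual l ll cl), b.
Qed.

End separation_tvs.

(** * Weak-star topologies *)

Section weakstar.
Context {R : realType} {E : tvsType R}.

Lemma weakstar_eval_continuous (x : E) :
  continuous (fun z : weakstar E => (z : dual E) x : R^o).
Proof.
move=> z.
have zz : (fun c : weakstar E => ((c : dual E) : {ptws E -> R^o})) @ z -->
    ((z : dual E) : {ptws E -> R^o}).
  exact: (@initial_continuous _ _
    (fun phi : dual E => (phi : {ptws E -> R^o})) z).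
move=> A zA.
refine (zz ((fun g : E -> R^o => g x) @^-1` A) _).
exact: (@proj_continuous E (fun=> R^o) x ((z : dual E) : {ptws E -> R^o}) A zA).
Qed.

(** The neighborhoods given by finitely many evaluations form a basis of
neighborhoods: they generate a filter that converges to [z]. *)
Lemma weakstar_nbhsP (z : weakstar E) (A : set (weakstar E)) : nbhs z A ->
  exists (s : seq E) (d : R), 0 < d /\
    forall c : dual E, (forall x, x \in s -> `|c x - (z : dual E) x| < d) -> A c.
Proof.
pose D (p : seq E * R) : set (dual E) :=
  [set c | forall x, x \in p.1 -> `|c x - (z : dual E) x| < p.2].
pose G : set_system (dual E) := filter_from [set p | 0 < p.2] D.
have FG : Filter G.
  apply: filter_from_filter; first by exists ([::], 1) => /=.
  move=> [s d] [s' d'] /= d0 d'0; exists (s ++ s', Num.min d d') => /=.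
    by rewrite lt_min d0.
  move=> c Dc; split=> x xs; have := Dc x; rewrite mem_cat xs ?orbT/= => /(_ isT);
    by rewrite lt_min => /andP[].
have Gz : (fun c : dual E => (c : {ptws E -> R^o})) @ G -->
    ((z : dual E) : {ptws E -> R^o}).
  apply/pointwise_cvgP => x; apply/(@cvgrPdist_lt _ R^o) => e e0.
  exists ([:: x], e) => // c /(_ x); rewrite mem_head => /(_ isT) /=.
  by rewrite distrC.
move=> -[_ [[B Bo <-] Bz] BA].
have [[s d] d0 DB] : G ((fun c : dual E => (c : {ptws E -> R^o})) @^-1` B).
  by apply: Gz; exact: open_nbhs_nbhs.
by exists s, d; split=> // c /DB; exact: BA.
Qed.

(** Separation by a weak-star continuous linear form, that is, by the evaluation
at a point. The points in [s] map the problem into a space of row vectors, where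
every linear form is a combination of the coordinates. *)
Lemma separation_weakstar (C : set (dual E * R^o)) (z : dual E) (r d : R)
    (s : seq E) :
  0 < d -> segment_closed C -> C !=set0 ->
  (forall c t, C (c, t) -> (forall x, x \in s -> `|c x - z x| < d) ->
    d <= `|t - r|) ->
  exists (x : E) (b : R),
    forall c t, C (c, t) -> z x + b * r + 1 <= c x + b * t.
Proof.
move=> d0 cC [[c0 t0] C0] Cs.
pose n := size s.
pose T (c : dual E) : 'rV[R]_n := \row_i c (s`_i).
pose C' : set ('rV[R]_n * R^o) := [set (T c.1, c.2) | c in C].
pose N (v : 'rV[R]_n) : R := (\sum_i `|v 0 i|) / d.
have N0 v : 0 <= N v by rewrite divr_ge0 ?sumr_ge0// ltW.
have sN : sublinear N.
  split=> [v w|t v tgt0]; rewrite /N.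
    rewrite -mulrDl ler_pM2r ?invr_gt0// -big_split/=.
    by apply: ler_sum => i _; rewrite mxE ler_normD.
  rewrite mulrA mulr_sumr le_eqVlt; apply/orP; left; apply/eqP.
  congr (_ / _); apply: eq_bigr => i _.
  by rewrite mxE normrM gtr0_norm.
have TD t a b : T (t *: a + b) = t *: T a + T b.
  by apply/rowP => i; rewrite !mxE dualDE dualZE.
have TZ t a : T (t *: a) = t *: T a.
  by apply/rowP => i; rewrite !mxE dualZE.
have cC' : segment_closed C'.
  move=> t _ _ t_ge0 t1 [[a a1] Ca <-] [[b b1] Cb <-].
  exists (t *: (a, a1) + (1 - t) *: (b, b1)); first exact: cC.
  by congr pair; rewrite /= TD TZ.
have C'0 : C' !=set0 by exists (T c0, t0), (c0, t0).
have NC' v t : C' (v, t) -> N (v - T z) < 1 -> d <= `|t - r|.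
  move=> [[c t'] Cc [<- <-]] /=; rewrite /N ltr_pdivrMr// mul1r => Nd.
  apply: (Cs c) => // x /(nthP 0)[i /= iltn <-].
  apply: le_lt_trans Nd.
  rewrite (bigD1 (Ordinal iltn))//= !mxE lerDl sumr_ge0//.
have [l [b [ll _ lC]]] := separation_product N C' (T z) r d sN N0 d0 cC' C'0 NC'.
pose L : {linear 'rV[R]_n -> R^o} :=
  HB.pack l (GRing.isLinear.Build R 'rV[R]_n R^o _ l ll).
have LT (c : dual E) : l (T c) = c (\sum_i L (delta_mx 0 i) *: s`_i).
  rewrite -[l (T c)]/(L (T c)) [T c in LHS]row_sum_delta !linear_sum.
  apply: eq_bigr => i _; rewrite [LHS]linearZ [RHS]linearZ mxE; exact: mulrC.
exists (\sum_i L (delta_mx 0 i) *: s`_i), b => c t Cc.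
by rewrite -!LT; apply: lC; exists (c, t).
Qed.

End weakstar.

Section tau_topology.
Context {R : realType} {X : tvsType R} (tau : lctopology (dual X)).
Context (weakstar_tau : @weakstar_open R X `<=` top_open tau).

Lemma tau_eval_continuous (x : X) :
  continuous (fun y : lcs tau => (y : dual X) x : R^o).
Proof.
apply/continuousP => A Ao; apply: weakstar_tau.
by move/continuousP : (@weakstar_eval_continuous R X x); exact.
Qed.

Lemma tau_eval_near (x : X) (y : dual X) (e : R) : 0 < e ->
  nbhs (y : lcs tau) [set u : dual X | `|y x - u x| < e].
Proof.
move=> e0; have /(@cvgrPdist_lt _ R^o) := tau_eval_continuous x (y : lcs tau).
exact.
Qed.

Lemma tau_eval_linear (x : X) :
  linear (fun y : lcs tau => (y : dual X) x : R^o).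
Proof. by []. Qed.

(** The canonical image of [x] in the bidual. It is tau-continuous because tau
is finer than the weak-star topology. *)
Definition evaluation (x : X) : dual (lcs tau) :=
  to_dual _ (tau_eval_linear x) (tau_eval_continuous x).

End tau_topology.

(** * Conjugates and biconjugates *)

Section real_bounds.
Context {R : realType}.

Lemma lee_real_ubounds (a b : \bar R) :
  (forall r : R, (b <= r%:E)%E -> (a <= r%:E)%E) -> (a <= b)%E.
Proof.
case: b => [r|_|h]; first exact.
  by rewrite leey.
case: a h => [a|/(_ 0 (leNye _))|//].
  by move=> /(_ (a - 1) (leNye _)); rewrite lee_fin => h; exfalso; lra.
by rewrite leye_eq.
Qed.

Lemma dadd_le_split {a b : \bar R} {r : R} : (-oo < a)%E -> (-oo < b)%E ->
  (a + b <= r%:E)%dE ->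
  exists r1 r2, [/\ (a <= r1%:E)%E, (b <= r2%:E)%E & r1 + r2 = r].
Proof.
case: a => [a| |]; case: b => [b| |] //= _ _.
rewrite lee_fin => abr; exists a, (r - a); split => //.
  by rewrite lee_fin; lra.
by lra.
Qed.

Lemma dadd_le_add {a b : \bar R} {r1 r2 : R} : (a <= r1%:E)%E ->
  (b <= r2%:E)%E -> (a + b <= (r1 + r2)%:E)%dE.
Proof.
case: a => [a| |]; case: b => [b| |] //=; rewrite ?leNye ?leye_eq// !lee_fin => ar br.
by rewrite lerD.
Qed.

Lemma split_ubound {A B : set R} {r : R} : A !=set0 -> B !=set0 ->
  (forall a b, A a -> B b -> a + b <= r) ->
  exists r1 r2, [/\ forall a, A a -> a <= r1, forall b, B b -> b <= r2 &
    r1 + r2 = r].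
Proof.
move=> [a0 Aa0] [b0 Bb0] AB.
have Aub : has_ubound A by exists (r - b0) => a Aa; have := AB a b0 Aa Bb0; lra.
exists (sup A), (r - sup A); split; last by lra.
  by move=> a Aa; exact: ub_le_sup.
move=> b Bb; have : sup A <= r - b.
  by apply: ge_sup; [exists a0|move=> a Aa; have := AB a b Aa Bb; lra].
by lra.
Qed.

Lemma unbounded_real (a b : R) : (forall t, 0 <= t -> a + t <= b) -> False.
Proof.
move=> /(_ (`|b - a| + 1)); have := ler_norm (b - a).
have := normr_ge0 (b - a); set n := `|_|; move=> n0 h /(_ ltac:(lra)); lra.
Qed.

Lemma slope_ge0 (a b : R) : (forall t, 0 <= t -> a <= b * t) -> 0 <= b.
Proof.
move=> ab; rewrite leNgt; apply/negP => b0.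
have := ab ((`|a| + 1) / - b).
rewrite invrN mulrN mulrN mulrCA divff ?lt_eqF// mulr1.
have -> : 0 <= - ((`|a| + 1) / b).
  by rewrite -mulrN -invrN divr_ge0// ?addr_ge0// oppr_ge0 ltW.
move=> /(_ isT); have := lerNnormlW (lexx `|a|).
by lra.
Qed.

End real_bounds.

Section conjugate.
Context {R : realType} {X : tvsType R}.
Implicit Types (f : X -> \bar R) (y : dual X) (rho : R).

(** An upper bound of the conjugate, in terms of the points of the epigraph. *)
Lemma conjugate_leP f y rho : (conjugate f y <= rho%:E)%E <->
  forall x (s : R), (f x <= s%:E)%E -> y x - s <= rho.
Proof.
split=> [h x s fs|h].
  have : ((y x)%:E - f x <= rho%:E)%E.
    by apply: le_trans h; apply: ereal_sup_ubound; exists x.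
  case: (f x) fs => [r| |] //=; rewrite ?lee_fin; first by lra.
apply: ge_ereal_sup => _ [x _ <-].
have := h x; case: (f x) => [r| |] /=.
- by move=> /(_ r (lexx _)); rewrite lee_fin.
- by rewrite leNye.
- by move=> {}h; exfalso; have := h (y x - rho - 1) (leNye _); lra.
Qed.

Lemma conjugate_convex {f y y' rho rho'} (t : R) : 0 <= t -> t <= 1 ->
  (conjugate f y <= rho%:E)%E -> (conjugate f y' <= rho'%:E)%E ->
  (conjugate f (t *: y + (1 - t) *: y')%R <= (t * rho + (1 - t) * rho')%:E)%E.
Proof.
move=> t0 t1 /conjugate_leP h /conjugate_leP h'; apply/conjugate_leP => x s fs.
rewrite dualDE !dualZE.
have := h x s fs; have := h' x s fs.
set a := y x; set b := y' x; move=> h2 h1.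
have : 0 <= t * (rho - (a - s)) by rewrite mulr_ge0// subr_ge0.
have : 0 <= (1 - t) * (rho' - (b - s)) by rewrite mulr_ge0// subr_ge0.
by lra.
Qed.

Lemma conjugate_dadd {f g y y' rho rho'} :
  (forall x, (-oo < f x)%E) -> (forall x, (-oo < g x)%E) ->
  (conjugate f y <= rho%:E)%E -> (conjugate g y' <= rho'%:E)%E ->
  (conjugate (fun x => f x + g x)%dE (y + y')%R <= (rho + rho')%:E)%E.
Proof.
move=> fNy gNy /conjugate_leP h /conjugate_leP h'; apply/conjugate_leP => x s.
move=> /(dadd_le_split (fNy x) (gNy x))[s1 [s2 [fs gs <-]]].
by rewrite dualDE; have := h x s1 fs; have := h' x s2 gs; lra.
Qed.

Lemma conjugate_minorant f : has_affine_minorant f ->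
  exists y rho, (conjugate f y <= rho%:E)%E.
Proof.
move=> [y [c yc]]; exists y, (- c); apply/conjugate_leP => x s fs.
by have := le_trans (yc x) fs; rewrite lee_fin; lra.
Qed.

Lemma subdiffP eps f x y : subdiff eps f x y <->
  exists r : R, [/\ f x = r%:E, 0 <= eps &
    (conjugate f y <= (y x + eps - r)%:E)%E].
Proof.
split=> [[fx e0 h]|[r [fxr e0 h]]].
  exists (fine (f x)); split=> //; first by rewrite fineK.
  move: fx h; case: (f x) => // r _ /=.
  by case: (conjugate f y) => [c| |] //=; rewrite ?leNye// !lee_fin; lra.
split=> //; rewrite fxr//.
by move: h; case: (conjugate f y) => [c| |] //=; rewrite ?leNye// !lee_fin; lra.
Qed.

End conjugate.

Section biconjugate.
Context {R : realType} {X : tvsType R} (tau : lctopology (dual X)).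
Context (weakstar_tau : @weakstar_open R X `<=` top_open tau).
Implicit Types (f : X -> \bar R) (z : dual (lcs tau)) (r : R).

(** [f**(z) <= r], where [f**(z)] is the supremum of [z y - conjugate f y]; only
the real upper bounds of the biconjugate are ever needed. *)
Definition biconjugate_le f z r :=
  forall (y : dual X) (rho : R), (conjugate f y <= rho%:E)%E -> z y - rho <= r.

Let z_lin z (a : R) (y y' : dual X) : z (a *: y + y') = a * z y + z y'.
Proof. by have := dual_is_linear z a y y'. Qed.

Lemma bidualD z (y y' : dual X) : z (y + y') = z y + z y'.
Proof. by have := z_lin z 1 y y'; rewrite scale1r mul1r. Qed.

Lemma bidualZ z (a : R) (y : dual X) : z (a *: y) = a * z y.
Proof.
have z0 : z (0 : dual X) = 0.
  have := z_lin z (-1) 0 0; rewrite addr0 scaler0 => h; lra.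
by have := z_lin z a y 0; rewrite z0 !addr0.
Qed.

Lemma hull_closed (V : preTopologicalLmodType R) (A : set V) :
  closed (closed_convex_hull A).
Proof. by apply: closed_bigI => C [[]]. Qed.

Lemma hull_segment_closed (V : preTopologicalLmodType R) (A : set V) :
  segment_closed (closed_convex_hull A).
Proof.
move=> t a b t0 t1 ha hb C CA; have [[_ cC] _] := CA.
have t01 : (0 <= t <= 1) by rewrite t0.
have := cC a b (Itv01 t0 t1) (mem_set (ha _ CA)) (mem_set (hb _ CA)).
by move=> /set_mem.
Qed.

(** The epigraph of the biconjugate is an intersection of closed half-spaces
that contain the epigraph of the extension of [f]. *)
Lemma biconjugate_le_clco f (z : bidual tau) r :
  (clco (bidual_ext f) z <= r%:E)%E -> biconjugate_le f z r.
Proof.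
move=> h y rho fy.
have : closed_convex_hull (epi (bidual_ext (tau := tau) f)) (z, r).
  by rewrite -epi_clco.
move=> /(_ [set p : bidual tau * R^o | 0 <= p.2 + rho - (p.1 : dual (lcs tau)) y]).
suff [H1 H2] : [set C : set (bidual tau * R^o) | closed C /\ convex_set C]
    [set p | 0 <= p.2 + rho - (p.1 : dual (lcs tau)) y] /\
    epi (bidual_ext (tau := tau) f) `<=`
    [set p | 0 <= p.2 + rho - (p.1 : dual (lcs tau)) y].
  by move=> /(_ (conj H1 H2)) /=; lra.
split; [split|].
- apply: (@preimage_closed _ _ (fun p : bidual tau * R^o =>
    p.2 + rho - (p.1 : dual (lcs tau)) y : R^o) [set t | 0 <= t]).
    move=> p _; apply: (@cvgB _ R^o).
      by apply: (@cvgD _ R^o); [exact: cvg_snd|exact: cvg_cst].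
    refine (cvg_comp fst (fun v : bidual tau => (v : dual (lcs tau)) y) _
      (@weakstar_eval_continuous _ (lcs tau) y p.1)).
    exact: cvg_fst.
  exact: closed_ge.
- move=> [v s] [v' s'] k /set_mem/= vs /set_mem/= v's'; apply/mem_set => /=.
  set a := (v : dual (lcs tau)) y; set a' := (v' : dual (lcs tau)) y.
  have k0 : 0 <= k%:num by [].
  have k1 : 0 <= 1 - k%:num by rewrite subr_ge0.
  have := mulr_ge0 k0 vs; have := mulr_ge0 k1 v's'; rewrite -/a -/a'.
  rewrite -[X in _ -> _ -> 0 <= X]/(k%:num * s + (1 - k%:num) * s' + rho -
    (k%:num * a + (1 - k%:num) * a')).
  lra.
- move=> [v s] /= vs; rewrite subr_ge0.
  apply/ler_addgt0Pr => e e0.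
  have : (bidual_ext (tau := tau) f v < (s + e)%:E)%E.
    by apply: le_lt_trans vs _; rewrite lte_fin ltrDl.
  move=> /ereal_inf_lt[_ [x vx <-]] /ltW fx.
  have /conjugate_leP/(_ x _ fx) := fy.
  by rewrite (vx y); lra.
Qed.

(** If [(z, r)] is not in the closed convex hull of the epigraph, then it is
separated from it by a point [y] of the dual and a slope [b >= 0]. If [b > 0],
then the affine function of slope [- b^-1 *: y] contradicts [f**(z) <= r]. If
[b = 0], then an arbitrarily large multiple of the separating functional can be
subtracted from an affine minorant of [f], so that [f**(z)] is infinite. *)
Lemma clco_le_biconjugate f (z : bidual tau) r : dom f !=set0 ->
  has_affine_minorant f ->
  biconjugate_le f z r -> (clco (bidual_ext f) z <= r%:E)%E.
Proof.
move=> [x0 fx0] fm bz.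
set F : bidual tau -> \bar R := bidual_ext f.
pose K : set (dual (lcs tau) * R^o) := closed_convex_hull (epi F).
apply: contrapT => Kz.
have {}Kz : (~` K) (z, r).
  by move=> Kzr; apply: Kz; suff : epi (clco F) (z, r) by []; rewrite epi_clco.
have fK x s : (f x <= s%:E)%E -> K (evaluation tau weakstar_tau x, s).
  move=> fxs C [_]; apply; rewrite /epi/=; apply: le_trans fxs.
  by apply: ereal_inf_lbound; exists x.
have [s0 fxs0] : exists s0 : R, (f x0 <= s0%:E)%E.
  move: fx0; rewrite /dom/=; case: (f x0) => // [s|] _; first by exists s.
  by exists 0; rewrite leNye.
have nKz : nbhs ((z, r) : bidual tau * R^o) (~` K).
  by apply: open_nbhs_nbhs; split=> //; apply: closed_openC; exact: hull_closed.
move: nKz => [[B1 B2] /= [/weakstar_nbhsP[s [d [d0 sB1]]] /nbhs_ballP[e /= e0 eB2]] BK].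
have [|||c t Kct cs|y [b yb]] :=
    separation_weakstar K (z : dual (lcs tau)) r (Num.min d e) s.
- by rewrite lt_min d0.
- exact: (@hull_segment_closed (bidual tau * R^o)%type (epi F)).
- by exists (evaluation tau weakstar_tau x0, s0); exact: fK.
- rewrite leNgt; apply/negP; rewrite lt_min => /andP[_ te].
  have : (~` K) (c, t) by apply: (BK (c, t)); split=> /=;
    [apply: sB1 => x /cs; rewrite lt_min => /andP[]|
     apply: eB2; rewrite -ball_normE/= distrC].
  exact.
have {}yb x t : (f x <= t%:E)%E ->
    (z : dual (lcs tau)) y + b * r + 1 <= (y : dual X) x + b * t.
  by move=> /fK /yb.
set zy := (z : dual (lcs tau)) y in yb.
have b0 : 0 <= b.
  apply: (@slope_ge0 _ (zy + b * r + 1 - (y : dual X) x0 - b * s0)) => t t0.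
  have : (f x0 <= (s0 + t)%:E)%E.
    by apply: le_trans fxs0 _; rewrite lee_fin lerDl.
  by move=> /yb; lra.
move: b0; rewrite le_eqVlt => /predU1P[b0|b0].
  have [y1 [rho y1rho]] := conjugate_minorant _ fm.
  apply: (@unbounded_real _ ((z : dual (lcs tau)) y1 - rho) r) => t t0.
  have := bz (- t *: (y : dual X) + y1) (rho - t * (zy + 1)).
  have H : (conjugate f (- t *: (y : dual X) + y1)%R <= (rho - t * (zy + 1))%:E)%E.
    apply/conjugate_leP => x u fu.
    have := yb x u fu; rewrite -b0 !mul0r !addr0 => hy.
    have /conjugate_leP/(_ x u fu) := y1rho.
    rewrite dualDE dualZE.
    have : 0 <= t * ((y : dual X) x - (zy + 1)) by rewrite mulr_ge0// subr_ge0.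
    lra.
  move=> /(_ H); rewrite bidualD bidualZ -/zy; lra.
have := bz (- b^-1 *: (y : dual X)) (- b^-1 * (zy + 1) - r).
have H : (conjugate f (- b^-1 *: (y : dual X))%R <= (- b^-1 * (zy + 1) - r)%:E)%E.
  apply/conjugate_leP => x u fu; rewrite dualZE.
  have b'0 : 0 <= b^-1 by rewrite invr_ge0 ltW.
  have := yb x u fu; rewrite -subr_ge0 => /(mulr_ge0 b'0).
  rewrite (_ : b^-1 * _ = b^-1 * ((y : dual X) x - zy - 1) + (u - r)); last first.
    by field; rewrite gt_eqF.
  lra.
move=> /(_ H); rewrite bidualZ -/zy.
have : 0 < b^-1 by rewrite invr_gt0.
lra.
Qed.

End biconjugate.

(** * The subdifferential sum rule *)

Section sum_rule.
Context {R : realType} {X : tvsType R} (tau : lctopology (dual X)).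
Context (weakstar_tau : @weakstar_open R X `<=` top_open tau).
Context (f g : X -> \bar R).
Context (f_gtNy : forall x, (-oo < f x)%E).
Context (g_gtNy : forall x, (-oo < g x)%E).
Context (dom_fg : (dom f `&` dom g) !=set0).
Context (f_minorant : has_affine_minorant f).
Context (g_minorant : has_affine_minorant g).

Let fg x := (f x + g x)%dE.

Let fg_fin x : (dom f `&` dom g) x ->
  exists r s : R, [/\ f x = r%:E, g x = s%:E & fg x = (r + s)%:E].
Proof.
rewrite /dom /fg/= => -[]; have := f_gtNy x; have := g_gtNy x.
by case: (f x) => // r; case: (g x) => // s; exists r, s.
Qed.

Let fg_dom x (r : R) : fg x = r%:E -> (dom f `&` dom g) x.
Proof.
rewrite /dom /fg/=; have := f_gtNy x; have := g_gtNy x.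
by case: (f x) => [a| |]; case: (g x) => [b| |] //= _ _ _; rewrite !ltry.
Qed.

Let fg_minorant : has_affine_minorant fg.
Proof.
have [y [c yc]] := f_minorant; have [y' [c' yc']] := g_minorant.
exists (y + y'), (c + c') => x; rewrite dualDE /fg.
have := yc x; have := yc' x; have := f_gtNy x; have := g_gtNy x.
case: (f x) => [a| |]; case: (g x) => [b| |] //= _ _; rewrite ?leey// !lee_fin.
lra.
Qed.

Let dom_fg0 : dom fg !=set0.
Proof.
have [x fgx] := dom_fg; exists x.
by have [r [s [_ _ fgE]]] := fg_fin x fgx; rewrite /dom/= fgE ltry.
Qed.

Let dom_f0 : dom f !=set0. Proof. by have [x []] := dom_fg; exists x. Qed.
Let dom_g0 : dom g !=set0. Proof. by have [x []] := dom_fg; exists x. Qed.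

Let clco_gtNy (h : X -> \bar R) (z : bidual tau) : has_affine_minorant h ->
  (-oo < clco (bidual_ext h) z)%E.
Proof.
move=> /conjugate_minorant[y [rho yrho]].
rewrite ltNye; apply/negP => /eqP hz.
have := @biconjugate_le_clco _ _ tau h z ((z : dual (lcs tau)) y - rho - 1).
by rewrite hz leNye => /(_ isT y rho yrho); lra.
Qed.

(** [(f + g)** <= f** + g**]. *)
Definition biconjugate_subadditive := forall (z : dual (lcs tau)) (r s : R),
  biconjugate_le tau f z r -> biconjugate_le tau g z s ->
  biconjugate_le tau fg z (r + s).

Lemma clco_add_biconjugate :
  (forall z : bidual tau, clco (bidual_ext fg) z =
     (clco (bidual_ext f) z + clco (bidual_ext g) z)%dE) ->
  biconjugate_subadditive.
Proof.
move=> H z r s fz gz; apply: biconjugate_le_clco; rewrite H.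
by apply: dadd_le_add; exact: clco_le_biconjugate.
Qed.

(** A bound on [f**(w) + g**(w)] is the sum of a bound on each term. *)
Lemma biconjugate_le_split (w : dual (lcs tau)) (r : R) :
  (forall (a b : dual X) (s t : R), (conjugate f a <= s%:E)%E ->
    (conjugate g b <= t%:E)%E -> w a - s + (w b - t) <= r) ->
  exists r1 r2, [/\ biconjugate_le tau f w r1, biconjugate_le tau g w r2 &
    r1 + r2 = r].
Proof.
move=> fgw.
pose A (h : X -> \bar R) := [set u : R | exists (a : dual X) s,
  (conjugate h a <= s%:E)%E /\ u = w a - s].
have A0 h : has_affine_minorant h -> A h !=set0.
  by move=> /conjugate_minorant[y [s hy]]; exists (w y - s), y, s.
have [||_ _ [a [s [fa ->]]] [b [t [gb ->]]]|r1 [r2 [Ar1 Br2 rr]]] :=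
    @split_ubound _ (A f) (A g) r; [exact: A0|exact: A0|exact: fgw|].
exists r1, r2; split=> // y rho hy; first by apply: Ar1; exists y, rho.
by apply: Br2; exists y, rho.
Qed.

Lemma biconjugate_clco_add : biconjugate_subadditive ->
  forall z : bidual tau, clco (bidual_ext fg) z =
    (clco (bidual_ext f) z + clco (bidual_ext g) z)%dE.
Proof.
move=> H z; apply/eqP; rewrite eq_le; apply/andP; split.
  apply: lee_real_ubounds => r.
  move=> /(dadd_le_split (clco_gtNy f z f_minorant) (clco_gtNy g z g_minorant)).
  move=> [r1 [r2 [/biconjugate_le_clco fz /biconjugate_le_clco gz <-]]].
  by apply: clco_le_biconjugate => //; exact: H.
apply: lee_real_ubounds => r /biconjugate_le_clco fgz.
have [a b s t fa gb|r1 [r2 [fz gz <-]]] := biconjugate_le_split z r.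
  by have := fgz _ _ (conjugate_dadd f_gtNy g_gtNy fa gb); rewrite bidualD; lra.
by apply: dadd_le_add; exact: clco_le_biconjugate.
Qed.

(** If [(f + g)** <= f** + g**], then the conjugate of [f + g] is the closure of
the infimal convolution of the conjugates. Otherwise [(y, rho)] is separated
from the epigraph [K] of the convolution by some [z] in the bidual and some
[k >= 0]. If [k > 0], then [(f + g)**] exceeds [f** + g**] at [- k^-1 *: z]. If
[k = 0], then it does so far away on the half-line that starts at the image of
a point of the common domain, in the direction [- z]. *)
Lemma inf_convolution_dense (y : dual X) (rho e : R) (U : set (dual X)) :
  biconjugate_subadditive -> (conjugate fg y <= rho%:E)%E -> 0 < e ->
  nbhs (y : lcs tau) U ->
  exists a b (s t : R), [/\ (conjugate f a <= s%:E)%E,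
    (conjugate g b <= t%:E)%E, U (a + b) & s + t <= rho + e].
Proof.
move=> H fgy e0 yU.
pose K : set (lcs tau * R^o) := [set p | exists a b (s t : R),
  [/\ (conjugate f a <= s%:E)%E, (conjugate g b <= t%:E)%E,
   p.1 = (a + b : dual X) & s + t <= p.2]].
apply: contrapT => noab.
have [y1 [s1 fy1]] := conjugate_minorant _ f_minorant.
have [y2 [s2 gy2]] := conjugate_minorant _ g_minorant.
have cK : segment_closed K.
  move=> l [c u] [c' u'] l0 l1 [a [b [s [t [/= fa gb -> stu]]]]].
  move=> [a' [b' [s' [t' [/= fa' gb' -> st'u']]]]].
  exists (l *: a + (1 - l) *: a'), (l *: b + (1 - l) *: b').
  exists (l * s + (1 - l) * s'), (l * t + (1 - l) * t'); split => /=.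
  - exact: conjugate_convex.
  - exact: conjugate_convex.
  - by rewrite [in RHS]addrACA -!scalerDr.
  - have l1' : 0 <= 1 - l by rewrite subr_ge0.
    rewrite -[leRHS]/(l * u + (1 - l) * u').
    have := ler_wpM2l l0 stu; have := ler_wpM2l l1' st'u'; lra.
have K0 : K !=set0 by exists (y1 + y2, s1 + s2), y1, y2, s1, s2.
have [c s [a [b [s' [t' [/= fa gb -> sts]]]]] Uc|z [k zk]] :=
    separation_tvs K (y : lcs tau) rho e U e0 cK K0 yU.
  rewrite leNgt; apply/negP; rewrite ltr_norml => /andP[_ se].
  apply: noab; exists a, b, s', t'; split=> //.
  by apply: le_trans sts _; move: se => /=; lra.
have {}zk a b (s t : R) : (conjugate f a <= s%:E)%E -> (conjugate g b <= t%:E)%E ->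
    z (y : lcs tau) + k * rho + 1 <= z (a + b : dual X) + k * (s + t).
  by move=> fa gb; apply: zk; exists a, b, s, t.
have mono (h : X -> \bar R) a (s s' : R) : s <= s' -> (conjugate h a <= s%:E)%E ->
    (conjugate h a <= s'%:E)%E.
  by move=> ss' /le_trans; apply; rewrite lee_fin.
have k0 : 0 <= k.
  apply: (@slope_ge0 _ (z (y : lcs tau) + k * rho + 1 - z (y1 + y2 : dual X) -
    k * (s1 + s2))) => t t0.
  have s1t : s1 <= s1 + t by rewrite lerDl.
  by have := zk _ _ _ _ (mono _ _ _ _ s1t fy1) gy2; lra.
move: k0; rewrite le_eqVlt => /predU1P[k0|k0].
  have [x0 x0d] := dom_fg.
  have [r0 [r0' [fx0 gx0 fgx0]]] := fg_fin x0 x0d.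
  pose ex := evaluation tau weakstar_tau x0.
  apply: (@unbounded_real _ (y x0 - rho) (r0 + r0')) => t t0.
  pose w : dual (lcs tau) := ex - t *: z.
  have wE v : w v = v x0 - t * z v by rewrite /w dualBE dualZE.
  have [a b s t' fa gb|r1 [r2 [fw gw rr]]] :=
      biconjugate_le_split w (r0 + r0' - t * (z (y : lcs tau) + 1)).
    rewrite !wE.
    have /conjugate_leP/(_ x0 r0) := fa; rewrite fx0 lexx => /(_ isT) h1.
    have /conjugate_leP/(_ x0 r0') := gb; rewrite gx0 lexx => /(_ isT) h2.
    have := zk _ _ _ _ fa gb; rewrite -k0 !mul0r !addr0 bidualD.
    by move=> /(ler_wpM2l t0); lra.
  by have := H _ _ _ fw gw _ _ fgy; rewrite rr wE; lra.
pose w : dual (lcs tau) := - k^-1 *: z.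
have wE v : w v = - k^-1 * z v by [].
have k'0 : 0 < k^-1 by rewrite invr_gt0.
have [a b s t fa gb|r1 [r2 [fw gw rr]]] :=
    biconjugate_le_split w (w (y : lcs tau) - rho - k^-1).
  have := zk _ _ _ _ fa gb; rewrite -(ler_pM2l k'0) !mulrDr !mulrA mulVf ?gt_eqF//.
  by rewrite !mul1r mulr1 !wE bidualD; lra.
by have := H _ _ _ fw gw _ _ fgy; rewrite rr; lra.
Qed.

Let cl_tauS (A B : set (dual X)) : A `<=` B -> cl_tau tau A `<=` cl_tau tau B.
Proof.
move=> AB y Ay U yU; have [u [Au Uu]] := Ay U yU.
by exists u; split=> //; exact: AB.
Qed.

(** The topology tau is finer than the weak-star topology, for which conjugates
are lower semicontinuous. *)
Lemma subdiff_tau_closed (h : X -> \bar R) (e : R) (x : X) :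
  cl_tau tau (subdiff e h x) `<=` subdiff e h x.
Proof.
move=> y cly.
have [u [/subdiffP[r [hx e0 _]] _]] := cly setT filterT.
apply/subdiffP; exists r; split=> //; apply/conjugate_leP => x' s hx's.
apply/ler_addgt0Pr => d d0; have d20 : 0 < d / 2 by rewrite divr_gt0.
have [v [/subdiffP[r' [hx' _ /conjugate_leP/(_ x' s hx's)]]]] := cly _ (filterI
  (tau_eval_near tau weakstar_tau x y (d / 2) d20)
  (tau_eval_near tau weakstar_tau x' y (d / 2) d20)).
move: hx'; rewrite hx => -[<-] /= vx'.
by rewrite !ltr_norml => -[/andP[? ?] /andP[? ?]]; lra.
Qed.

Lemma subdiff_le (h : X -> \bar R) (e e' : R) (x : X) : e <= e' ->
  subdiff e h x `<=` subdiff e' h x.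
Proof.
move=> ee' y /subdiffP[r [hx e0 hy]]; apply/subdiffP; exists r; split=> //.
  exact: le_trans ee'.
by apply: le_trans hy _; rewrite lee_fin lerD2r lerD2l.
Qed.

Lemma subdiff_sum_subset (e : R) (x : X) :
  subdiff_sum e f g x `<=` subdiff e fg x.
Proof.
move=> _ [[e1 e2] /= [<- e10 e20]] [a /subdiffP[r [fx _ fa]]
  [b /subdiffP[s [gx _ gb]] <-]].
apply/subdiffP; exists (r + s); split; first by rewrite /fg fx gx.
  exact: addr_ge0.
apply: le_trans (conjugate_dadd f_gtNy g_gtNy fa gb) _.
by rewrite lee_fin dualDE; lra.
Qed.

Lemma subdiff_subset_closure (e e' : R) (x : X) : biconjugate_subadditive ->
  e' < e -> subdiff e' fg x `<=` cl_tau tau (subdiff_sum e f g x).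
Proof.
move=> H e'e y /subdiffP[rs [fgx e'0 fgy]] U yU.
have [r [s [fx gx fgx']]] := fg_fin x (fg_dom x rs fgx).
move: fgx' fgy; rewrite fgx => -[->] fgy.
have d0 : 0 < (e - e') / 2 by rewrite divr_gt0// subr_gt0.
have [a [b [s1 [t1 [fa gb [Uab /= abx] st]]]]] := inf_convolution_dense y _ _ _
  H fgy d0 (filterI yU (tau_eval_near tau weakstar_tau x y _ d0)).
exists (a + b); split=> //.
have /conjugate_leP/(_ x r) := fa; rewrite fx lexx => /(_ isT) ax.
have /conjugate_leP/(_ x s) := gb; rewrite gx lexx => /(_ isT) bx.
have {abx} : `|y x - (a x + b x)| < (e - e') / 2 := abx.
rewrite ltr_norml => /andP[abx1 abx2].
(* s1 + r - a x bounds the gap in the Fenchel-Young inequality for f at x; what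
   remains of e bounds the gap for g *)
exists (s1 + r - a x, e - (s1 + r - a x)) => /=; first by split; lra.
exists a.
  by apply/subdiffP; exists r; split=> //; [lra|
    apply: le_trans fa _; rewrite lee_fin; lra].
exists b => //.
by apply/subdiffP; exists s; split=> //; [lra|
  apply: le_trans gb _; rewrite lee_fin; lra].
Qed.

Lemma subadditive_subdiff_eq : biconjugate_subadditive ->
  forall x, (dom f `&` dom g) x -> forall e : R, (eps_inf fg x < e%:E)%E ->
  subdiff e fg x = cl_tau tau (subdiff_sum e f g x).
Proof.
move=> H x xd e /ereal_inf_lt[_ [al [al0 [y0 y0al]] <-]]; rewrite lte_fin => ale.
apply/seteqP; split; last first.
  apply: subset_trans (@subdiff_tau_closed _ _ _).
  by apply: cl_tauS; exact: subdiff_sum_subset.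
move=> y ye U; rewrite nbhsE => -[B [Bo By] BU].
have [d d0 dB] := tvs_absorbing
  (@nbhs0_translate _ (lcs tau) _ _ (open_nbhs_nbhs (conj Bo By)))
  ((y0 : lcs tau) - (y : lcs tau)).
(* a point of the segment from y to y0, close to y *)
pose t := Num.min (d / 2) 1.
have t0 : 0 < t by rewrite lt_min ltr01 divr_gt0.
have t1 : t <= 1 by rewrite ge_min lexx orbT.
have td : `|t| < d.
  rewrite gtr0_norm// /t gt_min ltr_pdivrMr// ltr_pMr// ltr1n//.
pose yt : dual X := t *: y0 + (1 - t) *: y.
have Byt : B yt.
  have := dB _ td; rewrite /= /yt; congr B.
  by rewrite scalerBr scalerBl scale1r addrA addrAC.
have [r [s [fx gx fgx]]] := fg_fin x xd.
have ytfg : subdiff (t * al + (1 - t) * e) fg x yt.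
  move/subdiffP : y0al => [r1 [+ _ fgy0]]; rewrite fgx => -[fgy0E].
  move/subdiffP : ye => [r2 [+ e0 fgy]]; rewrite fgx => -[fgyE].
  apply/subdiffP; exists (r + s); split=> //.
    by rewrite addr_ge0// mulr_ge0// ?subr_ge0// ltW.
  apply: le_trans (conjugate_convex t (ltW t0) t1 fgy0 fgy) _.
  rewrite lee_fin dualDE !dualZE -fgy0E -fgyE; lra.
have te : t * al + (1 - t) * e < e.
  have : 0 < t * (e - al) by rewrite mulr_gt0// subr_gt0.
  lra.
have [v [vS Bv]] := subdiff_subset_closure _ _ _ H te _ ytfg B
  (open_nbhs_nbhs (conj Bo Byt)).
by exists v; split=> //; exact: BU.
Qed.

Lemma subdiff_eq_bigcap :
  (forall x, (dom f `&` dom g) x -> forall e : R, (eps_inf fg x < e%:E)%E ->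
    subdiff e fg x = cl_tau tau (subdiff_sum e f g x)) ->
  forall x, (dom f `&` dom g) x -> forall e : R, 0 < e ->
    subdiff e fg x =
    \bigcap_(al in [set al : R | e < al]) cl_tau tau (subdiff_sum al f g x).
Proof.
move=> H x xd e e0; apply/seteqP; split=> [y ye al /= eal|y ycl].
  rewrite -H//; first exact: (@subdiff_le _ _ _ _ (ltW eal)).
  apply: (@le_lt_trans _ _ e%:E); last by rewrite lte_fin.
  by apply: ereal_inf_lbound; exists e => //; split=> //; exists y.
have ysub al : e < al -> subdiff al fg x y.
  move=> eal; apply: subdiff_tau_closed.
  by apply: (cl_tauS _ _ (@subdiff_sum_subset al x)); exact: ycl.
have [r [s [fx gx fgx]]] := fg_fin x xd.
apply/subdiffP; exists (r + s); split=> //; first exact: ltW.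
apply/conjugate_leP => x' t fgx't; apply/ler_addgt0Pr => d d0.
have ed : e < e + d by rewrite ltrDl.
have /subdiffP[r' [+ _ /conjugate_leP/(_ x' t fgx't)]] := ysub _ ed.
by rewrite fgx => -[<-]; lra.
Qed.

Lemma bigcap_subdiff_subset :
  (forall x, (dom f `&` dom g) x -> forall e : R, 0 < e ->
    subdiff e fg x =
    \bigcap_(al in [set al : R | e < al]) cl_tau tau (subdiff_sum al f g x)) ->
  forall x (e : R), 0 < e -> subdiff e fg x `<=`
    cl_tau tau (minkowski_sum (subdiff (2 * e) f x) (subdiff (2 * e) g x)).
Proof.
move=> H x e e0 y ye.
have [r [fgx _ _]] := (subdiffP _ _ _ _).1 ye.
have e2 : e < 2 * e by lra.
move: ye; rewrite H//; last exact: fg_dom fgx.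
move=> /(_ (2 * e) e2); apply: cl_tauS.
move=> _ [[e1 e1'] /= [ee e10 e1'0]] [a fa [b gb <-]].
by exists a; [apply: subdiff_le fa; lra|exists b => //; apply: subdiff_le gb; lra].
Qed.

Lemma subdiff_subset_subadditive :
  (forall x (e : R), 0 < e -> subdiff e fg x `<=`
    cl_tau tau (minkowski_sum (subdiff (2 * e) f x) (subdiff (2 * e) g x))) ->
  biconjugate_subadditive.
Proof.
move=> H z r1 r2 fz gz y rho fgy.
(* two errors e come from the closure, and 4 e from the two subgradients *)
apply/ler_addgt0Pr => d d0; pose e := d / 6.
have e0 : 0 < e by rewrite divr_gt0.
have [c cE] : exists c : R, conjugate fg y = c%:E.
  move: fgy; have [x xd] := dom_fg; have [r [s [_ _ fgx]]] := fg_fin x xd.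
  have : ((y x - (r + s))%:E <= conjugate fg y)%E.
    by apply: ereal_sup_ubound; exists x => //; rewrite fgx.
  by case: (conjugate fg y) => // c _ _; exists c.
have crho : c <= rho by rewrite -lee_fin -cE.
have [x xc] : exists x, ((c - e)%:E < (y x)%:E - fg x)%E.
  have : ((c - e)%:E < conjugate fg y)%E by rewrite cE lte_fin ltrBlDr ltrDl.
  by move=> /ereal_sup_gt[_ [x _ <-]]; exists x.
have [v fgx] : exists v : R, fg x = v%:E.
  move: xc; rewrite /fg; have := f_gtNy x; have := g_gtNy x.
  by case: (f x) => [a| |]; case: (g x) => [b| |] //= _ _ _; exists (a + b).
move: xc; rewrite fgx lte_fin => xc.
have ye : subdiff e fg x y.
  apply/subdiffP; exists v; split=> //; first exact: ltW.
  by rewrite cE lee_fin; lra.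
have zy : nbhs (y : lcs tau) [set u : lcs tau | `|z (y : lcs tau) - z u| < e].
  have /(@cvgrPdist_lt _ R^o) := dual_continuous z (y : lcs tau).
  exact.
have [_ [[a /subdiffP[r [fx _ fa]] [b /subdiffP[s [gx _ gb]] <-]] [/= zab abx]]] :=
  H x e e0 y ye _ (filterI zy (tau_eval_near tau weakstar_tau x y _ e0)).
have := fz _ _ fa; have := gz _ _ gb.
have vE : v = r + s by move: fgx; rewrite /fg fx gx => -[].
have {abx} : `|y x - (a x + b x)| < e := abx.
have {zab} : `|z (y : lcs tau) - (z a + z b)| < e by rewrite -bidualD.
rewrite !ltr_norml => /andP[_ zab] /andP[abx _] zb za.
have /conjugate_leP/(_ x v) := fgy; rewrite fgx lexx => /(_ isT) yxv.
have -> : d = 6 * e by rewrite /e; field.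
by lra.
Qed.

End sum_rule.

Theorem theorem3 (R : realType) (X : tvsType R) (X_hausdorff : hausdorff_space X)
    (tau : lctopology (dual X))
    (weakstar_tau : @weakstar_open R X `<=` top_open tau)
    (tau_strong : top_open tau `<=` @strong_open R X)
    (f g : X -> \bar R)
    (f_gtNy : forall x, (-oo < f x)%E) (g_gtNy : forall x, (-oo < g x)%E)
    (dom_fg : (dom f `&` dom g) !=set0)
    (f_minorant : has_affine_minorant f) (g_minorant : has_affine_minorant g) :
  let fg := (fun x => f x + g x)%dE in
  [<-> (* (i) *)
       forall z : bidual tau, clco (bidual_ext fg) z =
         (clco (bidual_ext f) z + clco (bidual_ext g) z)%dE;
       (* (ii) *)
       forall x, (dom f `&` dom g) x ->
         forall eps : R, (eps_inf fg x < eps%:E)%E ->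
         subdiff eps fg x = cl_tau tau (subdiff_sum eps f g x);
       (* (iii) *)
       forall x, (dom f `&` dom g) x -> forall eps : R, 0 < eps ->
         subdiff eps fg x =
         \bigcap_(alpha in [set alpha : R | eps < alpha])
           cl_tau tau (subdiff_sum alpha f g x);
       (* (iv) *)
       forall x (eps : R), 0 < eps ->
         subdiff eps fg x `<=`
         cl_tau tau (minkowski_sum (subdiff (2 * eps) f x)
                                   (subdiff (2 * eps) g x)) ].
Proof.
move=> fg; tfae.
- move=> H; apply: subadditive_subdiff_eq => //.
  exact: clco_add_biconjugate.
- exact: subdiff_eq_bigcap.
- exact: bigcap_subdiff_subset.
- move=> H; apply: biconjugate_clco_add => //.
  exact: subdiff_subset_subadditive.
Qed.
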